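(* For every odd integer $n\ge 3$, the starting position of Weak $2$-coloring on the cycle with $n$ vertices is an $\mathcal{N}$-position.
   Context: Weak $2$-coloring is the following impartial game on an undirected graph. Two players alternate; a move chooses one uncolored vertex and assigns it one of two colors, such that the resulting partial coloring is legal. A partial coloring is legal if two adjacent vertices have the same color only when each of these two vertices is also adjacent to a vertex colored with the opposite color. Both players may use both colors. Colored vertices are never recolored. The player unable to move loses. The starting position is the one with all vertices uncolored. A position is a $\mathcal{P}$-position if the second player (the one not about to move) has a winning strategy, and an $\mathcal{N}$-position otherwise. *)

(* Defs.v *)
From mathcomp Require Import all_boot.

Set Implicit Arguments.
Unset Strict Implicit.
Unset Printing Implicit Defensive.

Section Weak2Coloring.

(* An undirected graph is given by its adjacency relation [e] on the vertex
   type [T]. *)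
Variables (T : finType) (e : rel T).

(* The two colors are the booleans; [None] marks an uncolored vertex. *)
Definition position := {ffun T -> option bool}.

Definition start : position := [ffun => None].

Definition colored_nbr (p : position) (u : T) (c : bool) : bool :=
  [exists w, e u w && (p w == Some c)].

Definition legal (p : position) : bool :=
  [forall u, forall v, forall c,
    [&& e u v, p u == Some c & p v == Some c] ==>
      (colored_nbr p u (~~ c) && colored_nbr p v (~~ c))].

Definition color_vertex (p : position) (v : T) (c : bool) : position :=
  [ffun u => if u == v then Some c else p u].

Definition move : rel position := fun p q =>
  [exists v, exists c,
    [&& p v == None, q == color_vertex p v c & legal q]].

(* [second_wins s p]: whoever is not about to move at [p] wins by answering
   every position [q] reached by the opponent with [s q].  Being inductive, it
   says that all plays following [s] are finite and leave the opponent without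
   a move. The values of [s] elsewhere are irrelevant. *)
Inductive second_wins (s : position -> position) (p : position) : Prop :=
  SecondWins of
    (forall q, move p q -> move q (s q)) &
    (forall q, move p q -> second_wins s (s q)).

Definition P_position (p : position) : Prop :=
  exists s : position -> position, second_wins s p.

Definition N_position (p : position) : Prop := ~ P_position p.

End Weak2Coloring.

Arguments start {T}.

(* [ordS] is the cyclic successor on ['I_n]; for [2 < n] this is the adjacency
   relation of the simple cycle on [n] vertices. *)
Definition cycle_adj (n : nat) : rel 'I_n :=
  fun i j => (j == ordS i) || (i == ordS j).

(* Main.v *)
Require Import Defs.
From mathcomp Require Import all_boot.

(** On an odd cycle the players cannot influence the length of the game: a play
    stops only when every vertex is colored, so it has exactly [n] moves, and
    the first player makes the last one because [n] is odd.

    The point is that a legal position with an uncolored vertex always admits a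
    move ([odd_cycle_move]).  Suppose that it does not, and let [i] be
    uncolored.  Then both colors occur next to [i], since otherwise a missing
    color could be put on [i].  Say that [ordS i] has color [c].  The vertex
    [ordS (ordS i)] cannot have color [c], because [ordS i] has no neighbor of
    the other color, nor the color opposite to [c], because then [c] would be
    allowed at [i]; so it is uncolored ([stuck_uncolored_step]).  Hence being
    uncolored propagates in steps of two around the cycle.  As [n] is odd, these
    steps reach every vertex, in particular the colored vertex [ordS i], a
    contradiction.

    Since every legal position with an odd number of uncolored vertices has a
    move, a strategy of the second player would lead from such positions to
    such positions forever ([odd_uncolored_not_second_wins]). *)

Section Graph.

Variables (T : finType) (e : rel T).

Definition uncolored (p : position T) : {set T} := [set v | p v == None].

Lemma legal_start : legal e start.
Proof.
apply/forallP=> u; apply/forallP=> v; apply/forallP=> c.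
by rewrite !ffunE /= andbF.
Qed.

Lemma colored_nbr_color_vertex {p : position T} {v u : T} {c d : bool} :
  p v = None -> colored_nbr e p u d -> colored_nbr e (color_vertex p v c) u d.
Proof.
move=> pv /existsP[w /andP[euw pw]]; apply/existsP; exists w.
rewrite euw ffunE; case: (eqVneq w v) => // wv.
by rewrite wv pv in pw.
Qed.

(** Coloring a vertex only adds neighbors of either color, so only the edges at
    the new vertex need checking. *)
Lemma legal_color_vertex (p : position T) (v : T) (c : bool) :
    symmetric e -> irreflexive e -> legal e p -> p v = None ->
    (forall u, e v u -> p u = Some c ->
       colored_nbr e p v (~~ c) && colored_nbr e p u (~~ c)) ->
  legal e (color_vertex p v c).
Proof.
move=> e_sym e_irr lp pv ok_v.
have mono := colored_nbr_color_vertex pv.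
apply/forallP=> u; apply/forallP=> w; apply/forallP=> d.
apply/implyP=> /and3P[euw]; rewrite [color_vertex p v c u]ffunE.
rewrite [color_vertex p v c w]ffunE.
case: (eqVneq u v) => [uv|_]; case: (eqVneq w v) => [wv|_].
- by rewrite uv wv e_irr in euw.
- rewrite uv in euw *; move=> /eqP[<-] /eqP pw.
  by have /andP[nv nw] := ok_v w euw pw; rewrite !mono.
- rewrite wv e_sym in euw *; move=> /eqP pu /eqP[cd]; rewrite -cd in pu *.
  by have /andP[nv nu] := ok_v u euw pu; rewrite !mono.
move=> pu pw; have /forallP/(_ u)/forallP/(_ w)/forallP/(_ d) := lp.
by rewrite euw pu pw /= => /andP[nu nw]; rewrite !mono.
Qed.

Lemma move_legal (p q : position T) : move e p q -> legal e q.
Proof. by case/existsP=> v /existsP[c /and3P[]]. Qed.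

Lemma card_uncolored_move (p q : position T) :
  move e p q -> #|uncolored p| = #|uncolored q|.+1.
Proof.
case/existsP=> v /existsP[c /and3P[pv /eqP-> _]].
rewrite (cardsD1 v) inE pv add1n; congr _.+1; apply: eq_card => u.
by rewrite !inE ffunE; case: (eqVneq u v).
Qed.

(** A move and its answer color two vertices, so the parity of the number of
    uncolored vertices survives each round; it can never reach the value zero,
    at which the opponent would be stuck. *)
Lemma odd_uncolored_not_second_wins s (p : position T) :
    (forall r v, legal e r -> r v = None -> exists q, move e r q) ->
    second_wins e s p -> legal e p ->
  ~~ odd #|uncolored p|.
Proof.
move=> movable; elim=> {}p answer _ IH lp; apply/negP=> odd_p.
have /card_gt0P[v] := odd_gt0 odd_p; rewrite inE => /eqP pv.
have [q pq] := movable p v lp pv; have qsq := answer q pq.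
have := IH q pq (move_legal _ _ qsq).
move: odd_p; rewrite (card_uncolored_move _ _ pq) (card_uncolored_move _ _ qsq).
by rewrite /= negbK => ->.
Qed.

End Graph.

Lemma cycle_adj_sym n : symmetric (@cycle_adj n).
Proof. by move=> i j; rewrite /cycle_adj orbC. Qed.

Lemma cycle_adj_pred n (i j : 'I_n) :
  cycle_adj i j = (j == ordS i) || (j == ord_pred i).
Proof.
rewrite /cycle_adj; congr (_ || _).
by apply/eqP/eqP=> ->; rewrite ?ordSK ?ord_predK.
Qed.

Lemma val_iter_ordS n k (i : 'I_n) : val (iter k (@ordS n) i) = (i + k) %% n.
Proof.
elim: k => [|k IH]; first by rewrite addn0 modn_small.
by rewrite iterS /= IH -addn1 modnDml addn1 addnS.
Qed.

Lemma cycle_adj_irr n : 1 < n -> irreflexive (@cycle_adj n).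
Proof.
move=> n_gt1 i; rewrite /cycle_adj orbb; apply/negP=> /eqP/(congr1 val)/= eq_i.
have := ltn_ord i; rewrite leq_eqVlt => /orP[/eqP Si|Si].
  by rewrite Si modnn in eq_i; rewrite -Si eq_i in n_gt1.
by rewrite modn_small // in eq_i; case: (n_Sn _ eq_i).
Qed.

(** An uncolored vertex of a stuck position sees both colors, and the color of
    [ordS i] can be repeated at [i] unless [ordS i] has no other colored
    neighbor. *)
Lemma stuck_uncolored_step {n : nat} {p : position 'I_n} {i : 'I_n} :
    1 < n -> legal (@cycle_adj n) p ->
    (forall q, ~~ move (@cycle_adj n) p q) -> p i = None ->
  p (ordS i) != None /\ p (ordS (ordS i)) = None.
Proof.
move=> n_gt1 lp stuck pi.
have adjS j : cycle_adj j (ordS j) by rewrite /cycle_adj eqxx.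
have blocked c : ~~ legal (@cycle_adj n) (color_vertex p i c).
  apply: contra (stuck (color_vertex p i c)) => lq.
  by apply/existsP; exists i; apply/existsP; exists c; rewrite pi !eqxx.
have legal_at c := legal_color_vertex _ _ p i c
  (@cycle_adj_sym n) (@cycle_adj_irr n n_gt1) lp pi.
have sees c : colored_nbr (@cycle_adj n) p i c.
  apply: contraNT (blocked c) => nc; apply: legal_at => u iu pu.
  by case/existsP: nc; exists u; rewrite iu pu eqxx.
have [c pS] : exists c, p (ordS i) = Some c.
  case pS: (p (ordS i)) => [c|]; first by exists c.
  (* the predecessor would be the only colored neighbor, of both colors *)
  have pP c : p (ord_pred i) = Some c.
    have /existsP[w /andP[]] := sees c; rewrite cycle_adj_pred.
    by case/orP=> /eqP-> /eqP //; rewrite pS.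
  by have := pP true; rewrite (pP false).
have pP : p (ord_pred i) = Some (~~ c).
  have /existsP[w /andP[]] := sees (~~ c); rewrite cycle_adj_pred.
  by case/orP=> /eqP-> /eqP //; rewrite pS => -[]; case: (c).
split; first by rewrite pS.
case pSS: (p (ordS (ordS i))) => [d|] //.
have [dc|dc] := eqVneq d c.
  have /forallP/(_ (ordS i))/forallP/(_ (ordS (ordS i)))/forallP/(_ c) := lp.
  rewrite adjS pS pSS dc eqxx /= => /andP[/existsP[w /andP[]]].
  rewrite cycle_adj_pred ordSK.
  by case/orP=> /eqP->; rewrite ?pi // pSS dc => /eqP[]; case: (c).
have {}dc : d = ~~ c by case: (d) (c) dc => [] [].
case/negP: (blocked c); apply: legal_at => u.
rewrite cycle_adj_pred => /orP[/eqP-> _|/eqP->].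
  rewrite sees; apply/existsP; exists (ordS (ordS i)).
  by rewrite adjS pSS dc /=.
by rewrite pP => -[]; case: (c).
Qed.

Lemma odd_cycle_move (n : nat) (p : position 'I_n) (i : 'I_n) :
    1 < n -> odd n -> legal (@cycle_adj n) p -> p i = None ->
  exists q, move (@cycle_adj n) p q.
Proof.
move=> n_gt1 n_odd lp pi.
apply/existsP; rewrite -[[exists q, _]]negbK; apply/negP=> /existsPn stuck.
have step j (pj : p j = None) := stuck_uncolored_step n_gt1 lp stuck pj.
have even_steps k : p (iter k.*2 (@ordS n) i) = None.
  by elim: k => [|k IH] //; rewrite doubleS !iterS; have [] := step _ IH.
(* [n.+1] is even, and [n.+1] steps from [i] end at its successor *)
have around : iter (n.+1)./2.*2 (@ordS n) i = ordS i.
  apply: val_inj; rewrite val_iter_ordS even_halfK /= ?n_odd //.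
  by rewrite -addSnnS modnDr.
by have [+ _] := step i pi; rewrite -around even_steps.
Qed.

Theorem theorem14 (n : nat) (hn : 3 <= n) (hodd : odd n) :
  N_position (@cycle_adj n) start.
Proof.
case=> s win.
have n_gt1 : 1 < n by apply: ltnW.
have := odd_uncolored_not_second_wins _ _ s start
  (fun r v => odd_cycle_move n r v n_gt1 hodd) win (legal_start _ _).
have -> : uncolored _ start = [set: 'I_n] by apply/setP=> v; rewrite !inE ffunE.
by rewrite cardsT card_ord hodd.
Qed.
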